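(* A permutation is rectangular if and only if it avoids the four patterns $2413$, $2431$, $4213$ and $4231$. Moreover, the number $r_n$ of rectangular elements in $\mathfrak S_n$ is given by $r_1=1$, $r_2=2$ and $r_n=4r_{n-1}-2r_{n-2}$ for every $n\ge3$.
   Context: A permutation $\tau\in\mathfrak S_n$ is called rectangular if for all $1\le i<k<j<\ell\le n$ the following two conditions are equivalent: (i) $\tau(i)>\tau(j)$ and $\tau(k)>\tau(\ell)$; (ii) $\tau(i)>\tau(\ell)$ and $\tau(k)>\tau(j)$. A permutation $\tau$ (in one-line notation $\tau(1)\tau(2)\cdots\tau(n)$) avoids a pattern $\sigma\in\mathfrak S_4$ if there are no positions $p_1<p_2<p_3<p_4$ such that $\tau(p_1),\tau(p_2),\tau(p_3),\tau(p_4)$ are in the same relative order as $\sigma(1),\sigma(2),\sigma(3),\sigma(4)$. *)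

(* Defs.v *)
From mathcomp Require Import all_boot all_order all_algebra all_fingroup.

Set Implicit Arguments.
Unset Strict Implicit.
Unset Printing Implicit Defensive.

(* Positions and values of a permutation of {1, ..., n} are both shifted down
   by one to lie in 'I_n; all notions below depend only on their order. *)

Definition rectangular (n : nat) (t : 'S_n) : bool :=
  [forall i : 'I_n, forall k : 'I_n, forall j : 'I_n, forall l : 'I_n,
    [&& i < k, k < j & j < l] ==>
      (((t i > t j) && (t k > t l)) == ((t i > t l) && (t k > t j)))].

Definition num_rectangular (n : nat) : nat := #|[set t : 'S_n | rectangular t]|.

Definition avoids (n m : nat) (t : 'S_n) (s : 'S_m) : Prop :=
  ~ exists p : 'I_m -> 'I_n,
      (forall a b : 'I_m, a < b -> p a < p b) /\
      (forall a b : 'I_m, (t (p a) < t (p b)) = (s a < s b)).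

Definition perm_of_oneline (n : nat) (w : n.-tuple 'I_n) (w_uniq : uniq w) :
  'S_n := perm (elimT (tuple_uniqP w) w_uniq).

Definition v1 : 'I_4 := @Ordinal 4 0 isT.
Definition v2 : 'I_4 := @Ordinal 4 1 isT.
Definition v3 : 'I_4 := @Ordinal 4 2 isT.
Definition v4 : 'I_4 := @Ordinal 4 3 isT.

Definition s2413 : 'S_4 := @perm_of_oneline 4 [tuple v2; v4; v1; v3] isT.
Definition s2431 : 'S_4 := @perm_of_oneline 4 [tuple v2; v4; v3; v1] isT.
Definition s4213 : 'S_4 := @perm_of_oneline 4 [tuple v4; v2; v1; v3] isT.
Definition s4231 : 'S_4 := @perm_of_oneline 4 [tuple v4; v2; v3; v1] isT.

Lemma rectangularP (n : nat) (t : 'S_n) :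
  reflect (forall i k j l : 'I_n, i < k -> k < j -> j < l ->
             (t i > t j /\ t k > t l) <-> (t i > t l /\ t k > t j))
          (rectangular t).
Proof.
apply: (iffP forallP) => [H i k j l ik kj jl|H i].
  have /forallP/(_ k)/forallP/(_ j)/forallP/(_ l) := H i.
  rewrite ik kj jl /= => /eqP E.
  by split=> /andP; [rewrite E | rewrite -E] => /andP.
apply/forallP=> k; apply/forallP=> j; apply/forallP=> l.
apply/implyP=> /and3P[ik kj jl]; have [H1 H2] := H i k j l ik kj jl.
by apply/eqP; apply/idP/idP => /andP; [move/H1/andP | move/H2/andP].
Qed.

(* Main.v *)
Require Import Defs.
From mathcomp Require Import all_boot all_order all_algebra all_fingroup.
From mathcomp Require Import zify.

(** A violation of rectangularity consists of positions p, q < r, s with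
    t r < t p < t s < t q. Hence [t] is rectangular iff for every [m] the set
    [S] of its first [m] values has no [r1 < l1 < r2 < l2] with [r1], [r2]
    outside [S] and [l1], [l2] in [S]; that is, [S] is an initial interval
    together with at most one further interval. Counting the ways to add the
    values one at a time, the number of completions depends only on the number
    [k] of missing values and on the length [b] of the gap between the two
    intervals. A gap [b >= 2] may shrink from either end, or the second interval
    may grow upwards; without a gap, any missing value may come next. If f(k)
    counts the completions without a gap and A(k) is the sum of the counts over
    [1 <= b <= k], then A(k+1) = f(k) + 3 A(k) and f(k+1) = f(k) + A(k). *)

(** * Interleaved values and the four patterns *)

Lemma ord_ltn_total (n : nat) (t : 'S_n) (i j : 'I_n) :
  i < j -> (t i < t j) || (t j < t i).
Proof.
move=> ij; rewrite -neq_ltn; apply/negP => /eqP/val_inj/perm_inj E.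
by rewrite E ltnn in ij.
Qed.

(** If exactly one of the two conditions holds, an inequality failing in the other one links its two
    inequalities into a chain. Conversely, a chain makes one condition true and the other false,
    whatever the order of [p], [q] and of [r], [s]. *)
Lemma rectangular_interleavingP (n : nat) (t : 'S_n) :
  reflect (forall p q r s : 'I_n, p < r -> p < s -> q < r -> q < s ->
             ~ [/\ t r < t p, t p < t s & t s < t q])
          (rectangular t).
Proof.
apply: (iffP (rectangularP t)) => [H p q r s pr ps qr qs [rp ps' sq]|H].
  have [pq|qp|/val_inj E] := ltngtP p q; last by rewrite E in ps'; lia.
  - have [rs|sr|/val_inj E] := ltngtP r s; last by rewrite E in rp; lia.
    + have := H p q r s pq qr rs; lia.
    + have := H p q s r pq qs sr; lia.
  - have [rs|sr|/val_inj E] := ltngtP r s; last by rewrite E in rp; lia.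
    + have := H q p r s qp pr rs; lia.
    + have := H q p s r qp ps sr; lia.
move=> i k j l ik kj jl.
have [ij kl] := (ltn_trans ik kj, ltn_trans kj jl).
have il := ltn_trans ij jl.
(* Either of [i], [k] may play [p], and either of [j], [l] may play [r]. Each of the four instances
   rules out the failure of one of the four inequalities. *)
have := H i k j l ij il kj kl; have := H i k l j il ij kl kj.
have := H k i j l kj kl ij il; have := H k i l j kl kj il ij.
move: (ord_ltn_total n t _ _ ij) (ord_ltn_total n t _ _ kl).
move: (ord_ltn_total n t _ _ il) (ord_ltn_total n t _ _ kj).
move: (ord_ltn_total n t _ _ ik) (ord_ltn_total n t _ _ jl).
move=> Nik Njl Nil Nkj Nij Nkl D4 D3 D2 D1.
clear - D1 D2 D3 D4 Nkl Nil Nij Njl Nkj Nik; split=> -[Ha Hb].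
- have/negP E1 : ~ t i < t l by move=> ?; apply: D1; split; lia.
  have/negP E2 : ~ t k < t j by move=> ?; apply: D4; split; lia.
  lia.
- have/negP E1 : ~ t i < t j by move=> ?; apply: D2; split; lia.
  have/negP E2 : ~ t k < t l by move=> ?; apply: D3; split; lia.
  lia.
Qed.

Lemma contains_of_chain (n : nat) (t : 'S_n) (s : 'S_4) (i k j l : 'I_n) :
  i < k -> k < j -> j < l ->
  (forall a b : 'I_4, (t (tnth [tuple i; k; j; l] a)
                       < t (tnth [tuple i; k; j; l] b)) = (s a < s b)) ->
  ~ avoids t s.
Proof.
move=> ik kj jl H; apply; exists (tnth [tuple i; k; j; l]); split=> // a b.
case: a => [[|[|[|[|a]]]] Ha] //; case: b => [[|[|[|[|b]]]] Hb] // _;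
  rewrite !(tnth_nth i) /=; lia.
Qed.

(** In a chain [t r < t p < t s < t q] these values have ranks 1, 2, 3, 4, so the two orders of [p],
    [q] and the two of [r], [s] spell exactly the four patterns. *)
Lemma rectangular_avoids (n : nat) (t : 'S_n) :
  rectangular t <->
  (avoids t s2413 /\ avoids t s2431 /\ avoids t s4213 /\ avoids t s4231).
Proof.
split.
- move/rectangularP => H.
  by do !split; case=> p [Hp Ht];
    have := H _ _ _ _ (Hp v1 v2 isT) (Hp v2 v3 isT) (Hp v3 v4 isT);
    move: (Ht v1 v3) (Ht v1 v4) (Ht v2 v3) (Ht v2 v4)
      (Ht v3 v1) (Ht v4 v1) (Ht v3 v2) (Ht v4 v2);
    rewrite !permE !(tnth_nth v1) /=; lia.
- case=> [H1 [H2 [H3 H4]]].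
  apply/rectangular_interleavingP => p q r s pr ps qr qs [rp ps' sq].
  have [pq|qp|/val_inj E] := ltngtP p q; last by rewrite E in ps'; lia.
  + have [rs|sr|/val_inj E] := ltngtP r s; last by rewrite E in rp; lia.
    * apply: (contains_of_chain n t s2413 p q r s) H1 => // a b.
      by case: a => [[|[|[|[|a]]]] Ha] //; case: b => [[|[|[|[|b]]]] Hb] //;
        rewrite !permE !(tnth_nth p) !(tnth_nth v1) /=; lia.
    * apply: (contains_of_chain n t s2431 p q s r) H2 => // a b.
      by case: a => [[|[|[|[|a]]]] Ha] //; case: b => [[|[|[|[|b]]]] Hb] //;
        rewrite !permE !(tnth_nth p) !(tnth_nth v1) /=; lia.
  + have [rs|sr|/val_inj E] := ltngtP r s; last by rewrite E in rp; lia.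
    * apply: (contains_of_chain n t s4213 q p r s) H3 => // a b.
      by case: a => [[|[|[|[|a]]]] Ha] //; case: b => [[|[|[|[|b]]]] Hb] //;
        rewrite !permE !(tnth_nth p) !(tnth_nth v1) /=; lia.
    * apply: (contains_of_chain n t s4231 q p s r) H4 => // a b.
      by case: a => [[|[|[|[|a]]]] Ha] //; case: b => [[|[|[|[|b]]]] Hb] //;
        rewrite !permE !(tnth_nth p) !(tnth_nth v1) /=; lia.
Qed.

(* [gap_completions k b] counts the ways to add the [k] missing values to a set
   consisting of two intervals separated by a gap of length [b]; for [b = 0] the
   set is a single initial interval. *)
Fixpoint gap_completions (k b : nat) : nat :=
  if k is k'.+1 then
    if b is b'.+1 then
      (0 < b').+1 * gap_completions k' b' + (b < k) * gap_completions k' b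
    else \sum_(j < k'.+1) gap_completions k' j
  else 1.

(** * Permutations as words whose prefix sets are noninterleaved *)

Section PrefixSets.

Variable n : nat.
Implicit Types (S : {set 'I_n}) (w : seq 'I_n).

Definition noninterleaved S : bool :=
  [forall r1 : 'I_n, forall l1 : 'I_n, forall r2 : 'I_n, forall l2 : 'I_n,
    ~~ [&& r1 < l1, l1 < r2, r2 < l2, r1 \notin S, l1 \in S, r2 \notin S
         & l2 \in S]].

Lemma noninterleavedP S :
  reflect (forall r1 l1 r2 l2 : 'I_n, r1 < l1 -> l1 < r2 -> r2 < l2 ->
             r1 \notin S -> l1 \in S -> r2 \notin S -> l2 \notin S)
          (noninterleaved S).
Proof.
apply: (iffP forallP) => [H r1 l1 r2 l2 h1 h2 h3 h4 h5 h6|H r1].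
  have /forallP/(_ l1)/forallP/(_ r2)/forallP/(_ l2) := H r1.
  by rewrite h1 h2 h3 h4 h5 h6.
apply/forallP=> l1; apply/forallP=> r2; apply/forallP=> l2.
by apply/negP => /and5P[h1 h2 h3 h4 /and3P[h5 h6]]; apply/negP; apply: H h4 h5 h6.
Qed.

(** The prefix of length 0 is included, so [S] itself is tested; this lets [completion_cons] peel
    off one letter. *)
Definition completion S w : bool :=
  [&& uniq w, all (fun x => x \notin S) w
    & all (fun m => noninterleaved (S :|: [set x in take m w]))
        (iota 0 (size w).+1)].

Fixpoint num_completions (k : nat) S : nat :=
  if noninterleaved S then
    if k is k'.+1 then \sum_(x | x \notin S) num_completions k' (x |: S) else 1
  else 0.

Lemma completion_nil S : completion S [::] = noninterleaved S.
Proof. by rewrite /completion /= setU0 andbT. Qed.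

Lemma completion_cons S x w :
  completion S (x :: w) =
  [&& noninterleaved S, x \notin S & completion (x |: S) w].
Proof.
have iotaE (P : pred nat) k :
    all P (iota 0 k.+2) = P 0 && all (fun m => P m.+1) (iota 0 k.+1).
  by rewrite -[iota 0 _]/(0 :: iota (1 + 0) k.+1) iotaDl /= all_map.
rewrite /completion iotaE take0 (_ : [set x in [::]] = set0) // setU0.
have -> : all (fun m => noninterleaved (S :|: [set y in take m.+1 (x :: w)]))
            (iota 0 (size w).+1)
        = all (fun m => noninterleaved (x |: S :|: [set y in take m w]))
            (iota 0 (size w).+1).
  apply: eq_all => m; congr noninterleaved.
  by apply/setP => y; rewrite !inE orbCA orbA.
have -> : all (fun y => y \notin x |: S) w
          = (x \notin w) && all (fun y => y \notin S) w.
  elim: (w) => //= y w' ->; rewrite !inE [x == y]eq_sym.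
  by case: (y == x); case: (x \in w'); rewrite ?andbF.
rewrite [uniq (_ :: _)]/= [all (fun x => x \notin S) (_ :: _)]/=.
case: (noninterleaved S); last by rewrite !andbF.
by case: (x \in w); case: (x \in S); case: (uniq w).
Qed.

Lemma sum_tuple_cons (T : finType) k (F : k.+1.-tuple T -> nat) :
  \sum_(w : k.+1.-tuple T) F w
  = \sum_(x : T) \sum_(w : k.-tuple T) F [tuple of x :: w].
Proof.
rewrite pair_bigA /= (reindex (fun p : T * k.-tuple T => [tuple of p.1 :: p.2])) //.
exists (fun w : k.+1.-tuple T => (thead w, [tuple of behead w])) => [[x w]|w] _.
  by congr pair; apply: val_inj.
by rewrite -tuple_eta.
Qed.

Lemma num_completionsE k S :
  num_completions k S = \sum_(w : k.-tuple 'I_n) completion S w.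
Proof.
elim: k S => [|k IH] S /=.
  rewrite (big_pred1 [tuple]) => [|w]; last by rewrite [w]tuple0 [RHS]/= eqxx.
  by rewrite completion_nil; case: noninterleaved.
rewrite sum_tuple_cons.
under [RHS]eq_bigr => x _ do
  (under eq_bigr => w _ do rewrite /= completion_cons).
case: noninterleaved => /=; last by rewrite big1 // => x _; rewrite big1.
rewrite big_mkcond; apply: eq_bigr => x _; case: (x \notin S) => /=.
  exact: IH.
by rewrite big1.
Qed.

Lemma mem_take_image (t : 'S_n) m i :
  (t i \in take m [seq t j | j <- enum 'I_n]) = (i < m).
Proof.
by rewrite -map_take mem_map ?in_take ?mem_enum ?index_enum_ord //; apply: perm_inj.
Qed.

(** A chain has [p], [q] before [r], [s], so cutting at the smaller of [r], [s] puts [t p], [t q] in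
    the prefix set and [t r], [t s] outside it. *)
Lemma completion_image (t : 'S_n) :
  completion set0 [seq t i | i <- enum 'I_n] = rectangular t.
Proof.
rewrite /completion map_inj_uniq ?enum_uniq; last exact: perm_inj.
rewrite (_ : all (fun x => x \notin set0) _); last by apply/allP=> x; rewrite inE.
rewrite size_map size_enum_ord !andTb.
apply/allP/rectangular_interleavingP => [H p q r s pr ps qr qs [rp ps' sq]|H m _].
  have [m [pm qm mr ms]] : exists m, [/\ p < m, q < m, m <= r & m <= s].
    by exists (minn r s); split; lia.
  have mi : m \in iota 0 n.+1 by rewrite mem_iota; have := ltn_ord r; lia.
  have /noninterleavedP/(_ _ _ _ _ rp ps' sq) := H m mi.
  by rewrite !inE !mem_take_image pm qm -!leqNgt mr ms => /(_ isT isT isT).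
apply/noninterleavedP => r s u v.
(* The four values are replaced by the positions at which [t] takes them. *)
rewrite -[r](permKV t) -[s](permKV t) -[u](permKV t) -[v](permKV t).
move: (t^-1 r)%g (t^-1 s)%g (t^-1 u)%g (t^-1 v)%g => {}r {}s {}u {}v.
rewrite !inE !mem_take_image => rs su uv mr ms mu; apply/negP => mv.
by apply: (H s v r u); first [lia | split].
Qed.

(** A repetition-free word of length [n] over ['I_n] is the one-line notation of a unique
    permutation. *)
Lemma num_rectangular_completions : num_rectangular n = num_completions n set0.
Proof.
rewrite num_completionsE /num_rectangular.
have inj : injective (fun t : 'S_n => [tuple t i | i < n]).
  move=> s t E; apply/permP => i.
  by have := congr1 (fun v => tnth v i) E; rewrite !tnth_mktuple.
rewrite -(card_imset _ inj) -sum1_card [LHS]big_mkcond.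
apply: eq_bigr => w _ /=; rewrite -[RHS]/(nat_of_bool _).
have -> : (w \in [set [tuple t i | i < n] | t : 'S_n
                    in [set t : 'S_n | rectangular t]]) = completion set0 w.
  apply/imsetP/idP => [[t]|cw].
    by rewrite inE -completion_image => ct ->.
  have /tuple_uniqP uw : uniq w by case/and3P: cw.
  have E : w = [tuple (perm uw) i | i < n].
    by apply: eq_from_tnth => i; rewrite tnth_mktuple permE.
  exists (perm uw) => //.
  by rewrite inE -completion_image; rewrite E in cw.
by case: completion.
Qed.

(** * Completions of a set of two intervals *)

Definition two_intervals (a b c : nat) : {set 'I_n} :=
  [set x : 'I_n | (x < a) || (a + b <= x < a + b + c)].

Lemma noninterleaved_two_intervals a b c : noninterleaved (two_intervals a b c).
Proof. by apply/noninterleavedP => r1 l1 r2 l2; rewrite !inE; lia. Qed.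

Lemma num_completions_interleaved k S :
  ~~ noninterleaved S -> num_completions k S = 0.
Proof. by case: k => [|k] /= /negbTE ->. Qed.

Lemma sum_ord_pred1 p v : \sum_(x < n) (x == p :> nat) * v = (p < n) * v.
Proof.
have [pn|np] := ltnP p n.
  rewrite (bigD1 (Ordinal pn)) //= eqxx big1 ?addn0 // => x.
  by rewrite -val_eqE /= => /negbTE ->.
by rewrite big1 // => x _; case: eqP => // E; have := ltn_ord x; lia.
Qed.

(** Induction on [k], sorting the next value by its place. The last hypothesis makes the description
    canonical: there is a second interval exactly when there is a gap. *)
Lemma num_completions_two_intervals k a b c :
  n = a + c + k -> b <= k -> (0 < b) = (0 < c) ->
  num_completions k (two_intervals a b c) = gap_completions k b.
Proof.
elim: k a b c => [|k IH] a b c nE bk bc.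
  by rewrite /= noninterleaved_two_intervals.
rewrite /= noninterleaved_two_intervals.
case: b bk bc => [|b] bk bc.
  have -> : c = 0 by lia.
  (* Without a gap, [x = a] prolongs the initial interval, and a larger [x] opens a gap of length
     [x - a]. *)
  transitivity (\sum_(x < n | a <= x) gap_completions k (x - a)).
    apply: eq_big => [x|x]; rewrite inE; first lia.
    move=> ax; have xn := ltn_ord x.
    have [E|ne] := eqVneq (x : nat) a.
      rewrite E subnn -(IH a.+1 0 0) //; last lia.
      by congr num_completions; apply/setP => y; rewrite !inE -val_eqE /=; lia.
    rewrite -(IH a (x - a) 1); try lia.
    by congr num_completions; apply/setP => y; rewrite !inE -val_eqE /=; lia.
  rewrite -(big_mkord (fun x => a <= x) (fun x => gap_completions k (x - a))).
  rewrite -(big_nat_widenl a 0 n xpredT) // -{1}[a]add0n big_addn.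
  have -> : n - a = k.+1 by lia.
  by rewrite big_mkord; apply: eq_bigr => j _; rewrite addnK.
pose v := gap_completions k.
(* The admissible values are the two ends of the gap, which coincide when [b = 0], and the value
   just above the second interval, which exists only if some missing value lies outside the gap. *)
transitivity (\sum_(x < n) ((x == a :> nat) * v b
   + ((x == a + b :> nat) * ((0 < b) * v b)
   + (x == a + b.+1 + c :> nat) * v b.+1))).
  rewrite big_mkcond; apply: eq_bigr => x _; have xn := ltn_ord x.
  rewrite inE; case: ifPn => xX; last by do 3!(case: eqP => ?; try lia).
  have [Ea|na] := eqVneq (x : nat) a.
    have -> : (x == a + b.+1 + c :> nat) = false by lia.
    rewrite mul1n mul0n addn0; case: (posnP b) => [b0|b0].
      (* Filling a gap of length one merges the two intervals. *)
      rewrite b0 muln0 addn0 /v -(IH (a + c).+1 0 0) //; last lia.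
      by congr num_completions; apply/setP => y; rewrite !inE -val_eqE /=; lia.
    have -> : (x == a + b :> nat) = false by lia.
    rewrite mul0n addn0 /v -(IH a.+1 b c); try lia.
    by congr num_completions; apply/setP => y; rewrite !inE -val_eqE /=; lia.
  have [Eb|nb] := eqVneq (x : nat) (a + b).
    have -> : (x == a + b.+1 + c :> nat) = false by lia.
    have b0 : 0 < b by lia.
    rewrite b0 !mul1n mul0n addn0 add0n /v -(IH a b c.+1); try lia.
    by congr num_completions; apply/setP => y; rewrite !inE -val_eqE /=; lia.
  have [Ec|nc] := eqVneq (x : nat) (a + b.+1 + c).
    rewrite !mul0n mul1n !add0n /v -(IH a b.+1 c.+1); try lia.
    by congr num_completions; apply/setP => y; rewrite !inE -val_eqE /=; lia.
  (* Any other [x] is isolated, either strictly inside the gap or beyond a second gap, and yields a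
     forbidden alternation. *)
  rewrite !mul0n num_completions_interleaved //; apply/negP.
  have an : a < n by lia.
  have cn : a + b.+1 < n by lia.
  have [xb|bx] := ltnP x (a + b).
    have bn : a + b < n by lia.
    move/noninterleavedP/(_ (Ordinal an) x (Ordinal bn) (Ordinal cn)).
    by rewrite !inE -!val_eqE /=; lia.
  have dn : a + b.+1 + c < n by lia.
  move/noninterleavedP/(_ (Ordinal an) (Ordinal cn) (Ordinal dn) x).
  by rewrite !inE -!val_eqE /=; lia.
rewrite !big_split /= !sum_ord_pred1.
have -> : a < n by lia.
have -> : a + b < n by lia.
have -> : (a + b.+1 + c < n) = (b.+1 < k.+1) by lia.
by rewrite /v; lia.
Qed.

End PrefixSets.

(** * The linear recurrence *)

Lemma num_rectangularE n : num_rectangular n = gap_completions n 0.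
Proof.
by rewrite num_rectangular_completions -(num_completions_two_intervals n n 0 0 0).
Qed.

Definition positive_gap_sum k := \sum_(j < k) gap_completions k j.+1.

Lemma gap_completions0S k :
  gap_completions k.+1 0 = gap_completions k 0 + positive_gap_sum k.
Proof. by rewrite /= big_ord_recl. Qed.

(** Over gaps of length 1 to [k.+1], shrinking leads once to gap 0 and twice to each gap of length 1
    to [k]. Growth of the second interval keeps the gap and contributes once for each length up to
    [k], nothing for [k.+1]. *)
Lemma positive_gap_sumS k :
  positive_gap_sum k.+1 = gap_completions k 0 + 3 * positive_gap_sum k.
Proof.
rewrite /positive_gap_sum /= big_split /=.
rewrite big_ord_recl [in X in _ + X]big_ord_recr /= ltnn mul0n addn0 mul1n.
rewrite -big_distrr /=.
rewrite [in X in _ + X](eq_bigr (fun j : 'I_k => gap_completions k j.+1)).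
  rewrite -[\sum_(j < k) gap_completions k (bump 0 j)]
           /(\sum_(j < k) gap_completions k j.+1).
  by lia.
by move=> j _; rewrite ltnS ltn_ord mul1n.
Qed.

Theorem corollary3p12 :
  (forall (n : nat) (t : 'S_n),
     rectangular t <->
     (avoids t s2413 /\ avoids t s2431 /\ avoids t s4213 /\ avoids t s4231)) /\
  num_rectangular 1 = 1 /\
  num_rectangular 2 = 2 /\
  (forall n : nat, 3 <= n ->
     ((num_rectangular n)%:Z =
        4 * (num_rectangular n.-1)%:Z - 2 * (num_rectangular n.-2)%:Z)%R).
Proof.
split; first exact: rectangular_avoids.
rewrite !num_rectangularE; split; first by rewrite /= big_ord1.
split; first by rewrite /= big_ord_recl !big_ord1.
move=> [|[|n]] // _; rewrite !num_rectangularE [n.+2.-1]/= [n.+2.-2]/=.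
(* In the notation f, A of the overview, A(n) = f(n+1) - f(n) is eliminated from f(n+2) = f(n+1) +
   f(n) + 3 A(n). *)
rewrite (gap_completions0S n.+1) positive_gap_sumS gap_completions0S; lia.
Qed.
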